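(* Let $k\in C([0,1]\times[0,1],\mathbb{R})$, let $M,N$ be real constants with $0<M<c_1$ and $N\neq0$, and let $G=G_M$ be the Green function of $y^{(4)}+My$ on $[0,1]$ with Navier boundary conditions $y(0)=y(1)=y''(0)=y''(1)=0$. Assume that $Nk(x,t)\ge 0$ for all $(x,t)\in[0,1]\times[0,1]$ and $$\|k\|_\infty:=\max_{(x,t)\in[0,1]\times[0,1]}|k(x,t)|<\frac{1}{|N|\,\max_{x\in[0,1]}\int_0^1G(x,s)\,ds}.$$ Let $p\in C[0,1]$, let $A,B,C,D\in\mathbb{R}$, and let $y\in C^4[0,1]$ be the unique solution of $$y^{(4)}(x)+My(x)-N\int_0^1k(x,t)y(t)\,dt=p(x),\quad x\in(0,1),$$ $$y(0)=A,\quad y(1)=B,\quad y''(0)=C,\quad y''(1)=D.$$ Then: (i) if $p(x)\ge0$ for all $x\in[0,1]$ and $A\ge0$, $B\ge0$, $C\le0$, $D\le0$, then $y(x)\ge0$ for all $x\in[0,1]$; (ii) if $p(x)\le0$ for all $x\in[0,1]$ and $A\le0$, $B\le0$, $C\ge0$, $D\ge0$, then $y(x)\le0$ for all $x\in[0,1]$.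
   Context: Functions are real-valued. For $M>0$, $G=G_M:[0,1]\times[0,1]\to\mathbb{R}$ is the unique continuous function such that for every $q\in C[0,1]$ the function $y(x)=\int_0^1G(x,s)q(s)\,ds$ is the unique $C^4[0,1]$ solution of $y^{(4)}(x)+My(x)=q(x)$ on $(0,1)$, $y(0)=y(1)=y''(0)=y''(1)=0$. The constant $c_1$ is $c_1=4k_1^4\approx125.14$, where $k_1\approx2.365$ is the smallest positive solution of $\tan k=-\tanh k$. Let $w$ and $\chi$ be the unique solutions of $y^{(4)}+My=0$ with, respectively, $y(0)=1,\ y''(0)=y(1)=y''(1)=0$, and $y(0)=0,\ y''(0)=1,\ y(1)=y''(1)=0$. It is known (Cabada, Cid, Sanchez, 2007) that for $0<M\le c_1$ one has $w\ge0$ and $\chi\le0$ on $[0,1]$; also $G_M\ge0$ on $[0,1]\times[0,1]$ for such $M$. Under the stated bound on $\|k\|_\infty$ the boundary value problem in the claim has exactly one solution (it is a Banach contraction fixed point), so ''the unique solution'' makes sense. *)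

(* Defs.v *)
From Stdlib Require Import Reals.
From Coquelicot Require Import Coquelicot.
Open Scope R_scope.

Definition unit_itv (x : R) : Prop := 0 <= x <= 1.

Definition unit_square (z : R * R) : Prop := unit_itv (fst z) /\ unit_itv (snd z).

(** Elements of [C[0,1]] and [C([0,1]x[0,1])] are total functions constrained
    only on the unit interval or square; [continuous_on] uses the subspace
    topology, so values outside are irrelevant. *)
Definition cont_itv (f : R -> R) : Prop := continuous_on unit_itv f.

Definition cont_square (f : R -> R -> R) : Prop :=
  continuous_on unit_square (fun z : R * R => f (fst z) (snd z)).

(** [y] is in [C^4[0,1]] with successive derivatives [y1], ..., [y4] there.
    [D_in] is differentiation relative to [0,1], hence one-sided at 0 and 1. *)
Definition C4_itv (y y1 y2 y3 y4 : R -> R) : Prop :=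
  (forall x, unit_itv x ->
     D_in y y1 unit_itv x /\ D_in y1 y2 unit_itv x /\
     D_in y2 y3 unit_itv x /\ D_in y3 y4 unit_itv x) /\
  cont_itv y4.

Definition navier_solution (M : R) (q y : R -> R) : Prop :=
  exists y1 y2 y3 y4 : R -> R,
    C4_itv y y1 y2 y3 y4 /\
    (forall x, 0 < x < 1 -> y4 x + M * y x = q x) /\
    y 0 = 0 /\ y 1 = 0 /\ y2 0 = 0 /\ y2 1 = 0.

Definition is_green (M : R) (G : R -> R -> R) : Prop :=
  cont_square G /\
  forall q : R -> R, cont_itv q ->
    navier_solution M q (fun x => RInt (fun s => G x s * q s) 0 1) /\
    forall z : R -> R, navier_solution M q z ->
      forall x, unit_itv x -> z x = RInt (fun s => G x s * q s) 0 1.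

Definition integro_solution (M N : R) (k : R -> R -> R) (p : R -> R)
    (A B C D : R) (y : R -> R) : Prop :=
  exists y1 y2 y3 y4 : R -> R,
    C4_itv y y1 y2 y3 y4 /\
    (forall x, 0 < x < 1 ->
       y4 x + M * y x - N * RInt (fun t => k x t * y t) 0 1 = p x) /\
    y 0 = A /\ y 1 = B /\ y2 0 = C /\ y2 1 = D.

(** [cos k <> 0] excludes the points where [tan] only has the junk value
    of a division by zero. *)
Definition pos_tan_root (k : R) : Prop :=
  0 < k /\ cos k <> 0 /\ tan k = - tanh k.

Definition is_k1 (k1 : R) : Prop :=
  pos_tan_root k1 /\ forall k, pos_tan_root k -> k1 <= k.

Definition is_max (E : R -> Prop) (m : R) : Prop :=
  E m /\ is_upper_bound E m.

Definition is_sup_norm (k : R -> R -> R) (m : R) : Prop :=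
  is_max (fun r => exists x t, unit_itv x /\ unit_itv t /\ r = Rabs (k x t)) m.

Definition is_max_int (G : R -> R -> R) (m : R) : Prop :=
  is_max (fun r => exists x, unit_itv x /\ r = RInt (fun s => G x s) 0 1) m.

(* Main.v *)
Require Import Defs.
From Stdlib Require Import Reals Lra.
From Coquelicot Require Import Coquelicot.
Open Scope R_scope.

(** The heart of the matter is a maximum principle ([maximum_principle]): if
    v'''' + M v >= 0 on (0,1), v >= 0 and v'' <= 0 at both endpoints, then
    v >= 0, as long as M < 4 k1^4.

    Write M = 4 m^4, so that 0 < m < k1.  With c = (1 - i) m, the Green
    function at (s, x), for s <= x, is a positive multiple of
    Im ((1 + i) sinh (c s) sinh (c (1 - x)) conj (sinh c)),
    and sinh ((1 - i) z) = [csh z] - i [sch z].  Three facts about the pair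
    ([sch], [csh]) control all the signs: [csh]/[sch] decreases on (0, pi)
    ([csh_sch_ratio_decr]); [csh] <= [sch] on [0, pi]; and [sch] + [csh] > 0
    on (0, k1), because a zero of [sch] + [csh] is a root of tan = - tanh.
    The first two make the kernel and its slope at 0 nonnegative
    ([green_nonneg], [green_slope_nonneg]), and the third settles the third
    derivative at 0 ([green_third_nonneg]), where the admissible range of M
    really enters.

    Given the kernel, the principle follows from Lagrange's identity.  The
    bilinear concomitant of v and the kernel ([flux]) has derivative
    kernel * (v'''' + M v) >= 0 and is nonnegative at 0 by the boundary data;
    the same holds from the other end by reflection.  The two concomitants at
    an interior point x add up to a positive multiple of v x ([flux_sum]),
    because only the third derivative of the Green function jumps there.

    For the integro-differential problem, let - mu = y xm be the minimum of y
    and suppose mu > 0.  As N k >= 0, the integral term is at least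
    - mu |N| knorm, so y + mu |N| knorm g satisfies the maximum principle,
    where g = int G solves the problem with right-hand side 1.  Hence
    - mu >= - mu |N| knorm gmax > - mu, which is absurd. *)

(** * Monotonicity *)

Lemma le_of_deriv_nonneg (f df : R -> R) (a b : R) :
  a <= b ->
  (forall x, a <= x <= b -> continuous f x) ->
  (forall x, a < x < b -> is_derive f x (df x)) ->
  (forall x, a < x < b -> 0 <= df x) ->
  f a <= f b.
Proof.
  intros Hab Hc Hd Hpos.
  (* The mean value point may be an endpoint, where [df] is unconstrained. *)
  destruct (MVT_gen f a b (fun x => Rmax (df x) 0)) as [c [_ Hfc]].
  - intros x Hx; rewrite Rmin_left, Rmax_right in Hx by lra.
    rewrite Rmax_left by (apply Hpos; lra). apply Hd; lra.
  - intros x Hx; rewrite Rmin_left, Rmax_right in Hx by lra.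
    apply continuity_pt_filterlim, Hc; lra.
  - assert (H := Rmax_r (df c) 0).
    assert (0 <= Rmax (df c) 0 * (b - a)) by (apply Rmult_le_pos; lra). lra.
Qed.

Lemma continuous_of_derivable (f : R -> R) (x : R) : ex_derive f x -> continuous f x.
Proof. apply (@ex_derive_continuous R_AbsRing R_NormedModule). Qed.

Lemma continuous_of_is_derive (f : R -> R) (x l : R) :
  is_derive f x l -> continuous f x.
Proof. intros H. apply continuous_of_derivable. now exists l. Qed.

(** * Hyperbolic functions *)

Lemma cosh_sqr (x : R) : cosh x * cosh x = 1 + sinh x * sinh x.
Proof.
  unfold cosh, sinh. assert (H : exp x * exp (- x) = 1).
  { rewrite <- exp_plus, Rplus_opp_r. apply exp_0. }
  nra.
Qed.

Lemma cosh_pos (x : R) : 0 < cosh x.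
Proof. unfold cosh. assert (H1 := exp_pos x). assert (H2 := exp_pos (- x)). lra. Qed.

Lemma sinh_nonneg (x : R) : 0 <= x -> 0 <= sinh x.
Proof.
  intros [H | <-]; [| rewrite sinh_0; lra].
  rewrite <- sinh_0. apply Rlt_le, sinh_lt, H.
Qed.

Lemma cosh_plus (x y : R) : cosh (x + y) = cosh x * cosh y + sinh x * sinh y.
Proof. unfold cosh, sinh. rewrite Ropp_plus_distr, !exp_plus. field. Qed.

Lemma cosh_opp (x : R) : cosh (- x) = cosh x.
Proof. unfold cosh. rewrite Ropp_involutive. lra. Qed.

Lemma sinh_plus (x y : R) : sinh (x + y) = sinh x * cosh y + cosh x * sinh y.
Proof. unfold cosh, sinh. rewrite Ropp_plus_distr, !exp_plus. field. Qed.

Lemma sinh_opp (x : R) : sinh (- x) = - sinh x.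
Proof. unfold sinh. rewrite Ropp_involutive. lra. Qed.

(** * A basis of solutions of f'''' + 4 f = 0 *)

Definition sch (x : R) : R := sin x * cosh x.
Definition csh (x : R) : R := cos x * sinh x.
Definition cch (x : R) : R := cos x * cosh x.
Definition ssh (x : R) : R := sin x * sinh x.

Lemma is_derive_sch (x : R) : is_derive sch x (cch x + ssh x).
Proof. unfold sch, csh, cch, ssh. auto_derive; [exact I | ring]. Qed.

Lemma is_derive_csh (x : R) : is_derive csh x (cch x - ssh x).
Proof. unfold sch, csh, cch, ssh. auto_derive; [exact I | ring]. Qed.

Lemma is_derive_cch (x : R) : is_derive cch x (csh x - sch x).
Proof. unfold sch, csh, cch, ssh. auto_derive; [exact I | ring]. Qed.

Lemma is_derive_ssh (x : R) : is_derive ssh x (csh x + sch x).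
Proof. unfold sch, csh, cch, ssh. auto_derive; [exact I | ring]. Qed.

(** These records let [auto_derive] differentiate the four functions. *)
#[local] Instance UnaryDiff_sch : UnaryDiff sch :=
  {| UnaryDiff_f' := _; UnaryDiff_H := is_derive_sch |}.
#[local] Instance UnaryDiff_csh : UnaryDiff csh :=
  {| UnaryDiff_f' := _; UnaryDiff_H := is_derive_csh |}.
#[local] Instance UnaryDiff_cch : UnaryDiff cch :=
  {| UnaryDiff_f' := _; UnaryDiff_H := is_derive_cch |}.
#[local] Instance UnaryDiff_ssh : UnaryDiff ssh :=
  {| UnaryDiff_f' := _; UnaryDiff_H := is_derive_ssh |}.

Lemma sch_0 : sch 0 = 0. Proof. unfold sch. rewrite sin_0. ring. Qed.
Lemma csh_0 : csh 0 = 0. Proof. unfold csh. rewrite sinh_0. ring. Qed.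
Lemma cch_0 : cch 0 = 1. Proof. unfold cch. rewrite cos_0, cosh_0. ring. Qed.
Lemma ssh_0 : ssh 0 = 0. Proof. unfold ssh. rewrite sin_0. ring. Qed.

Lemma sch_pos (x : R) : 0 < x < PI -> 0 < sch x.
Proof.
  intros H. apply Rmult_lt_0_compat; [apply sin_gt_0; lra | apply cosh_pos].
Qed.

Lemma sch_nonneg (x : R) : 0 <= x <= PI -> 0 <= sch x.
Proof.
  intros H. apply Rmult_le_pos; [apply sin_ge_0; lra | apply Rlt_le, cosh_pos].
Qed.

Lemma csh_le_sch (x : R) : 0 <= x <= PI -> csh x <= sch x.
Proof.
  intros Hx.
  assert (H : sch 0 - csh 0 <= sch x - csh x).
  { apply (le_of_deriv_nonneg (fun z => sch z - csh z) (fun z => 2 * ssh z)); [lra | | |].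
    - intros z _. apply (continuous_of_is_derive _ _ (2 * ssh z)). auto_derive; [exact I | ring].
    - intros z _. auto_derive; [exact I | ring].
    - intros z Hz. assert (0 <= ssh z); [| lra].
      apply Rmult_le_pos; [apply sin_ge_0 | apply sinh_nonneg]; lra. }
  rewrite sch_0, csh_0 in H. lra.
Qed.

(** The difference vanishes at 0 and has derivative 2 (sinh^2 + sin^2). *)
Lemma sin_cos_le_sinh_cosh (x : R) : 0 <= x -> sin x * cos x <= sinh x * cosh x.
Proof.
  intros Hx.
  assert (Hd : forall z, is_derive (fun z => sinh z * cosh z - sin z * cos z) z
                           (2 * sinh z * sinh z + 2 * sin z * sin z)).
  { intros z. auto_derive; [exact I |].
    assert (H1 := cosh_sqr z). assert (H2 := sin2_cos2 z). unfold Rsqr in H2. lra. }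
  assert (H : sinh 0 * cosh 0 - sin 0 * cos 0 <= sinh x * cosh x - sin x * cos x).
  { apply (le_of_deriv_nonneg (fun z => sinh z * cosh z - sin z * cos z)
             (fun z => 2 * sinh z * sinh z + 2 * sin z * sin z)); auto.
    - intros z _. eapply continuous_of_is_derive, Hd.
    - intros z _. nra. }
  rewrite sinh_0, sin_0 in H. lra.
Qed.

(** This Wronskian of [sch] and [csh] equals sinh cosh - sin cos. *)
Lemma wronskian_nonneg (x : R) :
  0 <= x -> 0 <= csh x * (cch x + ssh x) - (cch x - ssh x) * sch x.
Proof.
  intros Hx.
  replace (csh x * (cch x + ssh x) - (cch x - ssh x) * sch x)
    with (sinh x * cosh x - sin x * cos x).
  - assert (H := sin_cos_le_sinh_cosh x Hx). lra.
  - unfold sch, csh, cch, ssh. assert (H1 := cosh_sqr x).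
    assert (H2 := sin2_cos2 x). unfold Rsqr in H2.
    transitivity (sinh x * cosh x * (sin x * sin x + cos x * cos x)
                  - sin x * cos x * (cosh x * cosh x - sinh x * sinh x)).
    + rewrite H1, H2. ring.
    + ring.
Qed.

(** The ratio [csh] / [sch] = tanh / tan decreases, stated without division so
    that it covers the removable singularity at 0. *)
Lemma csh_sch_ratio_decr (x y : R) :
  0 <= x <= y -> y < PI -> sch x * csh y <= sch y * csh x.
Proof.
  intros [[Hx | <-] Hxy] Hy; [| rewrite sch_0, csh_0; lra].
  assert (Hd : forall z, x <= z <= y -> is_derive (fun z => - (csh z / sch z)) z
     ((csh z * (cch z + ssh z) - (cch z - ssh z) * sch z) / (sch z * sch z))).
  { intros z Hz. assert (Hs : 0 < sch z) by (apply sch_pos; lra).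
    auto_derive; [lra | field; lra]. }
  assert (H : - (csh x / sch x) <= - (csh y / sch y)).
  { apply (le_of_deriv_nonneg (fun z => - (csh z / sch z)) _ x y Hxy
      (fun z Hz => continuous_of_is_derive _ _ _ (Hd z Hz))
      (fun z Hz => Hd z (conj (Rlt_le _ _ (proj1 Hz)) (Rlt_le _ _ (proj2 Hz))))).
    intros z Hz. assert (Hs : 0 < sch z) by (apply sch_pos; lra).
    apply Rmult_le_pos; [apply wronskian_nonneg; lra |].
    apply Rlt_le, Rinv_0_lt_compat. now apply Rmult_lt_0_compat. }
  assert (Hsx : 0 < sch x) by (apply sch_pos; lra).
  assert (Hsy : 0 < sch y) by (apply sch_pos; lra).
  assert (H1 : sch x * sch y * (csh y / sch y) <= sch x * sch y * (csh x / sch x)).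
  { apply Rmult_le_compat_l; [apply Rlt_le; now apply Rmult_lt_0_compat | lra]. }
  replace (sch x * csh y) with (sch x * sch y * (csh y / sch y)) by (field; lra).
  replace (sch y * csh x) with (sch x * sch y * (csh x / sch x)) by (field; lra).
  exact H1.
Qed.

(** This identity and the next are the real and imaginary parts of
    cosh (a + b) - cosh (a - b) = 2 sinh a sinh b at a = (1 - i) u,
    b = (1 - i) t, since cosh ((1 - i) z) = [cch z] - i [ssh z]. *)
Lemma cch_sub_eq (u t : R) :
  cch (u + t) - cch (u - t) = 2 * (csh u * csh t - sch u * sch t).
Proof.
  unfold Rminus, cch, csh, sch.
  rewrite !cos_plus, !cosh_plus, cos_neg, sin_neg, cosh_opp, sinh_opp. ring.
Qed.

Lemma ssh_sub_eq (u t : R) :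
  ssh (u + t) - ssh (u - t) = 2 * (sch u * csh t + csh u * sch t).
Proof.
  unfold Rminus, ssh, csh, sch.
  rewrite !sin_plus, !sinh_plus, cos_neg, sin_neg, cosh_opp, sinh_opp. ring.
Qed.

Lemma cch_Rabs (x : R) : cch (Rabs x) = cch x.
Proof.
  unfold cch, Rabs. destruct (Rcase_abs x); [| reflexivity].
  rewrite cos_neg, cosh_opp. reflexivity.
Qed.

Lemma ssh_Rabs (x : R) : ssh (Rabs x) = ssh x.
Proof.
  unfold ssh, Rabs. destruct (Rcase_abs x); [| reflexivity].
  rewrite sin_neg, sinh_opp. ring.
Qed.

(** * The first root of tan = - tanh *)

Lemma sch_plus_csh_root (k : R) : 0 < k -> sch k + csh k = 0 -> pos_tan_root k.
Proof.
  intros Hk H. unfold sch, csh in H. assert (Hc := cosh_pos k).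
  assert (Hcos : cos k <> 0).
  { intros E. rewrite E in H. assert (Hs := sin2_cos2 k). unfold Rsqr in Hs.
    rewrite E in Hs. assert (sin k = 0) by nra. nra. }
  split; [exact Hk |]. split; [exact Hcos |].
  unfold tan, tanh. apply (Rmult_eq_reg_r (cos k * cosh k)).
  - transitivity (sin k * cosh k); [now field |].
    transitivity (- (cos k * sinh k)); [lra |]. field; lra.
  - apply Rmult_integral_contrapositive; split; lra.
Qed.

(** [sch] + [csh] is positive near 0, so a nonpositive value at z forces, by the
    intermediate value theorem, a root of tan = - tanh at or before z. *)
Lemma k1_le_of_sch_plus_csh_neg (k1 z : R) :
  is_k1 k1 -> 0 < z -> sch z + csh z <= 0 -> k1 <= z.
Proof.
  intros [_ Hmin] Hz Hneg.
  set (f := fun x => sch x + csh x).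
  assert (Hd : forall x, is_derive f x (2 * cch x)).
  { intros x. unfold f. auto_derive; [exact I | ring]. }
  set (e := Rmin z (PI / 2)).
  assert (HPI := PI_RGT_0).
  assert (He : 0 < e <= z /\ e <= PI / 2).
  { unfold e. split; [split |].
    - apply Rmin_pos; lra.
    - apply Rmin_l.
    - apply Rmin_r. }
  assert (Hfe : 0 < f e).
  { unfold f, sch, csh.
    assert (0 < sin e * cosh e).
    { apply Rmult_lt_0_compat; [apply sin_gt_0; lra | apply cosh_pos]. }
    assert (0 <= cos e * sinh e).
    { apply Rmult_le_pos; [apply cos_ge_0; lra | apply sinh_nonneg; lra]. }
    lra. }
  destruct (IVT_gen f e z 0) as [x [Hx Hfx]].
  - intros x. apply continuity_pt_filterlim. eapply continuous_of_is_derive, Hd.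
  - rewrite Rmin_right, Rmax_left by (unfold f in *; lra). unfold f in *; lra.
  - rewrite Rmin_left, Rmax_right in Hx by lra.
    apply Rle_trans with x; [| lra].
    apply Hmin, sch_plus_csh_root; [lra | exact Hfx].
Qed.

Lemma k1_le_PI (k1 : R) : is_k1 k1 -> k1 <= PI.
Proof.
  intros Hk. assert (HPI := PI_RGT_0).
  apply k1_le_of_sch_plus_csh_neg; [exact Hk | lra |].
  unfold sch, csh. rewrite sin_PI, cos_PI. assert (H := sinh_nonneg PI). lra.
Qed.

(** The range of m in which the Green kernel and its boundary derivatives have
    the right signs; for 0 < m < pi the second condition says m < k1. *)
Definition admissible (m : R) : Prop :=
  0 < m < PI /\ 0 < sch m + csh m.

Lemma admissible_of_lt_k1 (k1 m : R) : is_k1 k1 -> 0 < m < k1 -> admissible m.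
Proof.
  intros Hk Hm. assert (H := k1_le_PI k1 Hk). split; [lra |].
  destruct (Rlt_or_le 0 (sch m + csh m)) as [Hp | Hn]; [exact Hp |].
  assert (H1 := k1_le_of_sch_plus_csh_neg k1 m Hk (proj1 Hm) Hn). lra.
Qed.

(** * Positivity of the Green kernel *)

(** After scaling the interval to [0, m], the Green function with pole at
    distance u from the right end is, at s <= m - u, proportional to
    Im ((P + i Q) * ([csh s] - i [sch s])) = Q [csh s] - P [sch s], where
    P + i Q = (1 + i) ([csh m] + i [sch m]) ([csh u] - i [sch u]);
    [green_sin] is P and [green_cos] is Q. *)
Definition green_sin (m u : R) : R :=
  (csh m - sch m) * csh u + (csh m + sch m) * sch u.
Definition green_cos (m u : R) : R :=
  (csh m + sch m) * csh u - (csh m - sch m) * sch u.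

(** The solutions of f'''' + 4 f = 0 with f(0) = f''(0) = 0, followed by their
    first three derivatives. *)
Definition ker (P Q z : R) : R := Q * csh z - P * sch z.
Definition ker1 (P Q z : R) : R := Q * (cch z - ssh z) - P * (cch z + ssh z).
Definition ker2 (P Q z : R) : R := - 2 * Q * sch z - 2 * P * csh z.
Definition ker3 (P Q z : R) : R := - 2 * Q * (cch z + ssh z) - 2 * P * (cch z - ssh z).

(** Q - P is the slope of the kernel at 0, and by expansion it is twice
    [sch m] [csh u] - [csh m] [sch u]. *)
Lemma green_slope_nonneg (m u : R) :
  admissible m -> 0 <= u <= m -> green_sin m u <= green_cos m u.
Proof.
  intros [Hm _] Hu. unfold green_sin, green_cos.
  assert (H := csh_sch_ratio_decr u m). lra.
Qed.

(** Up to the factor -2 this is the third derivative of the kernel at 0, and it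
    is twice [sch m] [sch u] + [csh m] [csh u].  If [csh m] < 0, then
    [sch m] > - [csh m] and [sch u] >= [csh u] give the sign. *)
Lemma green_third_nonneg (m u : R) :
  admissible m -> 0 <= u <= m -> 0 <= green_sin m u + green_cos m u.
Proof.
  intros [Hm Hpos] Hu. unfold green_sin, green_cos.
  assert (H1 := csh_le_sch u). assert (H2 := sch_nonneg u).
  assert (H3 : 0 < sch m) by (apply sch_pos; lra).
  assert (H4 : 0 <= sch m * sch u + csh m * csh u); [| lra].
  destruct (Rle_or_lt 0 (csh m)) as [Hc | Hc].
  - (* [csh m >= 0] forces [csh u >= 0]. *)
    assert (H5 := csh_sch_ratio_decr u m ltac:(lra) ltac:(lra)).
    assert (0 <= sch u * csh m) by (apply Rmult_le_pos; lra).
    assert (0 <= csh u) by nra. nra.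
  - nra.
Qed.

(** On the diagonal the product of two hyperbolic sines is a difference of two
    hyperbolic cosines, so the kernel is (F m - F |u - t|) / 2 for an F whose
    derivative is nonnegative on [0, m] by [csh_sch_ratio_decr]. *)
Lemma green_diag_nonneg (m t u : R) :
  admissible m -> 0 <= t -> 0 <= u -> t + u = m ->
  0 <= ker (green_sin m u) (green_cos m u) t.
Proof.
  intros [Hm _] Ht Hu Htu.
  set (a := csh m). set (b := sch m).
  set (F := fun z => (a + b) * cch z - (a - b) * ssh z).
  assert (Hd : forall z, is_derive F z (2 * (b * csh z - a * sch z))).
  { intros z. unfold F. auto_derive; [exact I | ring]. }
  set (r := Rabs (u - t)).
  assert (Hr : 0 <= r <= m).
  { unfold r. split; [apply Rabs_pos | apply Rabs_le; lra]. }
  assert (H : F r <= F m).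
  { apply (le_of_deriv_nonneg F (fun z => 2 * (b * csh z - a * sch z))); auto.
    - lra.
    - intros z _. eapply continuous_of_is_derive, Hd.
    - intros z Hz. assert (H := csh_sch_ratio_decr z m). fold a b in H. lra. }
  unfold F, r in H. rewrite cch_Rabs, ssh_Rabs in H.
  assert (H1 := cch_sub_eq u t). assert (H2 := ssh_sub_eq u t).
  replace (u + t) with m in H1, H2 by lra.
  unfold ker, green_sin, green_cos. fold a b.
  assert (H3 : 0 <= (a + b) * (cch m - cch (u - t)) - (a - b) * (ssh m - ssh (u - t))) by lra.
  rewrite H1, H2 in H3. lra.
Qed.

(** When Q >= 0, monotonicity of [csh] / [sch] reduces positivity on [0, t] to
    positivity at t; when Q < 0, then P <= Q < 0 and [csh] <= [sch] suffice. *)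
Lemma green_nonneg (m t u z : R) :
  admissible m -> 0 <= u -> t + u = m -> 0 <= z <= t ->
  0 <= ker (green_sin m u) (green_cos m u) z.
Proof.
  intros Hm Hu Htu Hz.
  assert (Hdiag := green_diag_nonneg m t u Hm ltac:(lra) Hu Htu).
  assert (Hslope := green_slope_nonneg m u Hm ltac:(lra)).
  destruct Hm as [Hm _].
  set (P := green_sin m u) in *. set (Q := green_cos m u) in *.
  assert (Hs := sch_nonneg z). assert (Hcs := csh_le_sch z).
  unfold ker in *.
  destruct (Rle_or_lt 0 Q) as [HQ | HQ]; [| nra].
  destruct (Rle_lt_or_eq_dec 0 z ltac:(lra)) as [Hz0 | <-];
    [| rewrite sch_0, csh_0; lra].
  assert (Hst : 0 < sch t) by (apply sch_pos; lra).
  assert (Hr := csh_sch_ratio_decr z t ltac:(lra) ltac:(lra)).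
  apply (Rmult_le_reg_l (sch t)); [exact Hst |].
  assert (0 <= sch z * (Q * csh t - P * sch t)) by (apply Rmult_le_pos; lra).
  assert (Q * (sch z * csh t) <= Q * (sch t * csh z)) by (apply Rmult_le_compat_l; lra).
  lra.
Qed.

(** * Maximum principle *)

(** Four times differentiable on (0,1), with derivatives up to the third
    extended continuously to the line: the form in which two-sided derivatives and the mean value theorem apply. *)
Record smooth4 (v v1 v2 v3 v4 : R -> R) : Prop := {
  smooth4_cont : forall x, continuous v x /\ continuous v1 x /\
                           continuous v2 x /\ continuous v3 x;
  smooth4_deriv : forall x, 0 < x < 1 ->
    is_derive v x (v1 x) /\ is_derive v1 x (v2 x) /\
    is_derive v2 x (v3 x) /\ is_derive v3 x (v4 x)
}.

(** The bilinear concomitant of v and s |-> [ker P Q (m s)]. *)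
Definition flux (m P Q : R) (v v1 v2 v3 : R -> R) (s : R) : R :=
  ker P Q (m * s) * v3 s - m * ker1 P Q (m * s) * v2 s
  + m ^ 2 * ker2 P Q (m * s) * v1 s - m ^ 3 * ker3 P Q (m * s) * v s.

(** By Lagrange's identity the concomitant has derivative
    kernel * (v'''' + 4 m^4 v); its value at 0 is
    m (P - Q) v''(0) + 2 m^3 (P + Q) v(0). *)
Lemma flux_nonneg (m P Q x0 : R) (v v1 v2 v3 v4 : R -> R) :
  smooth4 v v1 v2 v3 v4 ->
  0 < m -> 0 < x0 < 1 ->
  P <= Q -> 0 <= P + Q ->
  (forall z, 0 <= z <= m * x0 -> 0 <= ker P Q z) ->
  (forall x, 0 < x < 1 -> 0 <= v4 x + 4 * m ^ 4 * v x) ->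
  0 <= v 0 -> v2 0 <= 0 ->
  0 <= flux m P Q v v1 v2 v3 x0.
Proof.
  intros [Hc Hd] Hm Hx0 HPQ HPQ' Hker Hop Hv0 Hv20.
  assert (H0 : 0 <= flux m P Q v v1 v2 v3 0).
  { unfold flux, ker, ker1, ker2, ker3. rewrite !Rmult_0_r, sch_0, csh_0, cch_0, ssh_0.
    assert (Hm3 := pow_lt m 3 Hm).
    assert (0 <= m * (Q - P) * - v2 0).
    { repeat apply Rmult_le_pos; lra. }
    assert (0 <= m ^ 3 * (P + Q) * v 0).
    { repeat apply Rmult_le_pos; lra. }
    lra. }
  apply Rle_trans with (1 := H0).
  apply (le_of_deriv_nonneg _
           (fun s => ker P Q (m * s) * (v4 s + 4 * m ^ 4 * v s))); [lra | | |].
  - intros s _. destruct (Hc s) as (C0 & C1 & C2 & C3). unfold flux.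
    assert (Ck : forall f : R -> R, ex_derive f s ->
                 forall w, continuous w s -> continuous (fun s => f s * w s) s).
    { intros f Hf w Hw. apply (continuous_mult f w); [| exact Hw].
      now apply continuous_of_derivable. }
    unfold ker, ker1, ker2, ker3.
    apply (continuous_minus (V := R_NormedModule)); [apply (continuous_plus (V := R_NormedModule));
      [apply (continuous_minus (V := R_NormedModule)) |] |];
      apply Ck; auto; auto_derive; exact I.
  - intros s Hs. destruct (Hd s ltac:(lra)) as (D0 & D1 & D2 & D3).
    unfold flux, ker, ker1, ker2, ker3. auto_derive.
    + repeat split; eexists; eassumption.
    + rewrite (is_derive_unique (fun x : R => v x) _ _ D0), (is_derive_unique (fun x : R => v1 x) _ _ D1),
        (is_derive_unique (fun x : R => v2 x) _ _ D2), (is_derive_unique (fun x : R => v3 x) _ _ D3).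
      ring.
  - intros s Hs. apply Rmult_le_pos; [apply Hker | apply Hop; lra].
    split; [apply Rmult_le_pos; lra | apply Rmult_le_compat_l; lra].
Qed.

Lemma smooth4_reflect (v v1 v2 v3 v4 : R -> R) :
  smooth4 v v1 v2 v3 v4 ->
  smooth4 (fun x => v (1 - x)) (fun x => - v1 (1 - x)) (fun x => v2 (1 - x))
          (fun x => - v3 (1 - x)) (fun x => v4 (1 - x)).
Proof.
  intros [Hc Hd].
  assert (Hr : forall x, continuous (fun x => 1 - x) x).
  { intros x. apply continuous_of_derivable. now auto_derive. }
  assert (Hcr : forall f : R -> R, (forall x, continuous f x) ->
            forall x, continuous (fun x => f (1 - x)) x).
  { intros f Hf x. apply (continuous_comp (fun x => 1 - x) f); [apply Hr | apply Hf]. }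
  split.
  - intros x. refine (conj _ (conj _ (conj _ _))).
    + apply (Hcr v); intros; apply Hc.
    + apply (continuous_opp (V := R_NormedModule)), (Hcr v1); intros; apply Hc.
    + apply (Hcr v2); intros; apply Hc.
    + apply (continuous_opp (V := R_NormedModule)), (Hcr v3); intros; apply Hc.
  - intros x Hx. destruct (Hd (1 - x) ltac:(lra)) as (D0 & D1 & D2 & D3).
    refine (conj _ (conj _ (conj _ _))); auto_derive; try (repeat split; eexists; eassumption).
    + rewrite (is_derive_unique (fun x : R => v x) (1 + - x) _ D0). ring.
    + rewrite (is_derive_unique (fun x : R => v1 x) (1 + - x) _ D1). ring.
    + rewrite (is_derive_unique (fun x : R => v2 x) (1 + - x) _ D2). ring.
    + rewrite (is_derive_unique (fun x : R => v3 x) (1 + - x) _ D3). ring.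
Qed.

(** The kernels built from the two ends agree at x0 up to the second derivative,
    which cancels the terms in v', v'', v'''; the third derivatives differ by
    the jump of the Green function. *)
Lemma flux_sum (m x0 : R) (v v1 v2 v3 : R -> R) :
  flux m (green_sin m (m * (1 - x0))) (green_cos m (m * (1 - x0))) v v1 v2 v3 x0 +
  flux m (green_sin m (m * x0)) (green_cos m (m * x0))
       (fun x => v (1 - x)) (fun x => - v1 (1 - x)) (fun x => v2 (1 - x))
       (fun x => - v3 (1 - x)) (1 - x0)
  = 4 * m ^ 3 * (sch m ^ 2 + csh m ^ 2) * v x0.
Proof.
  unfold flux. replace (1 - (1 - x0)) with x0 by ring.
  set (t := m * x0). set (u := m * (1 - x0)).
  assert (Hm : m = t + u) by (unfold t, u; ring).
  assert (Hsch : sch m = sch t * cch u + csh t * ssh u + cch t * sch u + ssh t * csh u).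
  { rewrite Hm. unfold sch, csh, cch, ssh. rewrite sin_plus, cosh_plus. ring. }
  assert (Hcsh : csh m = csh t * cch u - sch t * ssh u + cch t * csh u - ssh t * sch u).
  { rewrite Hm. unfold sch, csh, cch, ssh. rewrite cos_plus, sinh_plus. ring. }
  unfold ker, ker1, ker2, ker3, green_sin, green_cos.
  set (a := csh m) in *. set (b := sch m) in *.
  (* Only the coefficients of [v x0] and [v2 x0] survive; the brackets are the
     addition formulas for [b] and [a], so that the coefficient of [v2 x0]
     becomes [a * b - b * a]. *)
  transitivity
    (m ^ 3 * (4 * b * (sch t * cch u + csh t * ssh u + cch t * sch u + ssh t * csh u)
              + 4 * a * (csh t * cch u - sch t * ssh u + cch t * csh u - ssh t * sch u))
       * v x0
     + m * v2 x0 * 2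
       * (a * (sch t * cch u + csh t * ssh u + cch t * sch u + ssh t * csh u)
          - b * (csh t * cch u - sch t * ssh u + cch t * csh u - ssh t * sch u))).
  - ring.
  - rewrite <- Hsch, <- Hcsh. ring.
Qed.

(** Each of the two fluxes through x is nonnegative, and their sum is a positive
    multiple of [v x]. *)
Lemma maximum_principle (m : R) (v v1 v2 v3 v4 : R -> R) :
  admissible m -> smooth4 v v1 v2 v3 v4 ->
  (forall x, 0 < x < 1 -> 0 <= v4 x + 4 * m ^ 4 * v x) ->
  0 <= v 0 -> 0 <= v 1 -> v2 0 <= 0 -> v2 1 <= 0 ->
  forall x, 0 <= x <= 1 -> 0 <= v x.
Proof.
  intros Hm Hv Hop H0 H1 H20 H21 x Hx.
  destruct (Rle_lt_or_eq_dec 0 x ltac:(lra)) as [Hx0 | <-]; [| exact H0].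
  destruct (Rle_lt_or_eq_dec x 1 ltac:(lra)) as [Hx1 | ->]; [| exact H1].
  assert (Hm0 : 0 < m) by (destruct Hm; lra).
  assert (Ht : 0 < m * x) by (apply Rmult_lt_0_compat; lra).
  assert (Hu : 0 < m * (1 - x)) by (apply Rmult_lt_0_compat; lra).
  assert (Hleft := flux_nonneg m (green_sin m (m * (1 - x))) (green_cos m (m * (1 - x)))
                     x v v1 v2 v3 v4 Hv Hm0 ltac:(lra)).
  assert (Hright := flux_nonneg m (green_sin m (m * x)) (green_cos m (m * x))
                      (1 - x) _ _ _ _ _ (smooth4_reflect _ _ _ _ _ Hv) Hm0 ltac:(lra)).
  assert (Hsum := flux_sum m x v v1 v2 v3).
  cbv beta in Hright. rewrite Rminus_0_r in Hright.
  assert (H : 0 <= 4 * m ^ 3 * (sch m ^ 2 + csh m ^ 2) * v x).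
  { rewrite <- Hsum. apply Rplus_le_le_0_compat.
    - apply Hleft; auto.
      + apply green_slope_nonneg; [exact Hm | lra].
      + apply green_third_nonneg; [exact Hm | lra].
      + intros z Hz. apply (green_nonneg m (m * x)); auto; lra.
    - apply Hright; auto.
      + apply green_slope_nonneg; [exact Hm | lra].
      + apply green_third_nonneg; [exact Hm | lra].
      + intros z Hz. apply (green_nonneg m (m * (1 - x))); auto; lra.
      + intros s Hs. apply Hop. lra. }
  apply (Rmult_le_reg_l (4 * m ^ 3 * (sch m ^ 2 + csh m ^ 2))); [| lra].
  apply Rmult_lt_0_compat.
  - assert (H3 := pow_lt m 3 Hm0). lra.
  - assert (Hs : 0 < sch m) by (apply sch_pos; destruct Hm; lra).
    assert (0 <= csh m ^ 2) by apply pow2_ge_0. assert (0 < sch m ^ 2) by (now apply pow_lt). lra.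
Qed.

(** * Functions relative to the unit interval *)

(** Precomposing with the retraction onto [0,1] turns continuity and
    differentiability relative to [0,1] into the unrestricted notions, without
    changing any value on [0,1]. *)
Definition clamp (x : R) : R := Rmax 0 (Rmin 1 x).

Lemma clamp_unit (x : R) : unit_itv (clamp x).
Proof.
  unfold clamp, unit_itv. split; [apply Rmax_l |].
  apply Rmax_lub; [lra | apply Rmin_l].
Qed.

Lemma clamp_id (x : R) : unit_itv x -> clamp x = x.
Proof. intros [H0 H1]. unfold clamp. rewrite Rmin_right, Rmax_right; lra. Qed.

Lemma clamp_lipschitz (x y : R) : Rabs (clamp x - clamp y) <= Rabs (x - y).
Proof.
  unfold clamp, Rmax, Rmin.
  repeat destruct Rle_dec; unfold Rabs; repeat destruct Rcase_abs; lra.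
Qed.

Lemma continuous_clamp (x : R) : continuous clamp x.
Proof.
  apply filterlim_locally. intros eps. exists eps. intros z Hz.
  apply Rle_lt_trans with (2 := Hz). apply clamp_lipschitz.
Qed.

Lemma continuous_on_comp_clamp (T : UniformSpace) (D : T -> Prop) (f : T -> R) (g : R -> T) :
  continuous_on D f -> (forall t, D (g t)) -> (forall t, continuous g t) ->
  forall t, continuous (fun t => f (g t)) t.
Proof.
  intros Hf HD Hg t P HP.
  assert (H := Hg t _ (Hf (g t) (HD t) P HP)). unfold filtermap in H.
  unfold filtermap. revert H. apply filter_imp. intros s Hs. now apply Hs.
Qed.

Lemma cont_itv_clamp (f : R -> R) (x : R) :
  cont_itv f -> continuous (fun t => f (clamp t)) x.
Proof.
  intros Hf. revert x. apply (continuous_on_comp_clamp _ unit_itv f clamp Hf clamp_unit).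
  exact continuous_clamp.
Qed.

Lemma cont_square_clamp (f : R -> R -> R) (x t : R) :
  cont_square f -> unit_itv x -> continuous (fun s => f x (clamp s)) t.
Proof.
  intros Hf Hx. revert t.
  apply (continuous_on_comp_clamp _ unit_square (fun z => f (fst z) (snd z))
           (fun s => (x, clamp s)) Hf).
  - intros t. split; [exact Hx | apply clamp_unit].
  - intros t. apply filterlim_locally. intros eps.
    assert (H := proj1 (filterlim_locally _ _) (continuous_clamp t) eps).
    revert H. apply filter_imp. intros s Hs. split; [apply ball_center | exact Hs].
Qed.

Lemma D_in_clamp_continuous (f d : R -> R) :
  (forall x, unit_itv x -> D_in f d unit_itv x) ->
  forall x, continuous (fun t => f (clamp t)) x.
Proof.
  intros Hd. intros x. apply cont_itv_clamp. clear x. intros x Hx.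
  apply filterlim_locally. intros eps.
  destruct (cont_deriv f d unit_itv x (Hd x Hx) eps (cond_pos eps)) as [al [Hal H]].
  exists (mkposreal al Hal). intros z Hz Hzu.
  destruct (Req_dec z x) as [-> | Hne]; [apply ball_center |].
  apply (H z). repeat split; auto; apply Hzu.
Qed.

Lemma D_in_is_derive_clamp (f d : R -> R) (x : R) :
  0 < x < 1 -> D_in f d unit_itv x -> is_derive (fun t => f (clamp t)) x (d (clamp x)).
Proof.
  intros Hx Hd. assert (Hu : unit_itv x) by (split; lra).
  rewrite (clamp_id x Hu).
  assert (Hloc : locally x (fun z => unit_itv z)).
  { assert (He : 0 < Rmin x (1 - x)) by (apply Rmin_pos; lra).
    exists (mkposreal _ He). intros z Hz. unfold ball in Hz; simpl in Hz.
    unfold AbsRing_ball, abs, minus, plus, opp in Hz; simpl in Hz.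
    assert (H1 := Rmin_l x (1 - x)). assert (H2 := Rmin_r x (1 - x)).
    apply Rabs_def2 in Hz. split; lra. }
  apply (is_derive_ext_loc f).
  { revert Hloc. apply filter_imp. intros z Hz. now rewrite clamp_id. }
  apply is_derive_Reals. intros eps Heps.
  destruct (Hd eps Heps) as [al [Hal H]]. destruct Hloc as [e He].
  assert (Hmin : 0 < Rmin al e) by (apply Rmin_pos; [exact Hal | apply cond_pos]).
  exists (mkposreal _ Hmin). intros h Hh Hhd. simpl in Hhd.
  assert (H1 := Rmin_l al e). assert (H2 := Rmin_r al e).
  replace ((f (x + h) - f x) / h) with ((f (x + h) - f x) / (x + h - x)) by (f_equal; ring).
  apply (H (x + h)). repeat split.
  - apply He. unfold ball; simpl. unfold AbsRing_ball, abs, minus, plus, opp; simpl.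
    replace (x + h + - x) with h by ring. lra.
  - apply He. unfold ball; simpl. unfold AbsRing_ball, abs, minus, plus, opp; simpl.
    replace (x + h + - x) with h by ring. lra.
  - lra.
  - simpl. unfold Rdist. replace (x + h - x) with h by ring. lra.
Qed.

Lemma smooth4_of_C4_itv (v v1 v2 v3 v4 : R -> R) :
  C4_itv v v1 v2 v3 v4 ->
  smooth4 (fun x => v (clamp x)) (fun x => v1 (clamp x)) (fun x => v2 (clamp x))
          (fun x => v3 (clamp x)) (fun x => v4 (clamp x)).
Proof.
  intros [Hd _]. split.
  - intros x. refine (conj _ (conj _ (conj _ _)));
      [apply (D_in_clamp_continuous v v1) | apply (D_in_clamp_continuous v1 v2)
      | apply (D_in_clamp_continuous v2 v3) | apply (D_in_clamp_continuous v3 v4)];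
      intros z Hz; apply (Hd z Hz).
  - intros x Hx. assert (Hu : unit_itv x) by (split; lra).
    destruct (Hd x Hu) as (D0 & D1 & D2 & D3).
    refine (conj _ (conj _ (conj _ _))); now apply D_in_is_derive_clamp.
Qed.

Lemma C4_itv_lin_comb (c : R) (u u1 u2 u3 u4 w w1 w2 w3 w4 : R -> R) :
  C4_itv u u1 u2 u3 u4 -> C4_itv w w1 w2 w3 w4 ->
  C4_itv (fun x => u x + c * w x) (fun x => u1 x + c * w1 x) (fun x => u2 x + c * w2 x)
         (fun x => u3 x + c * w3 x) (fun x => u4 x + c * w4 x).
Proof.
  intros [Hu Cu] [Hw Cw]. split.
  - intros x Hx. destruct (Hu x Hx) as (U0 & U1 & U2 & U3).
    destruct (Hw x Hx) as (W0 & W1 & W2 & W3).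
    refine (conj _ (conj _ (conj _ _))); apply Dadd; auto; now apply Dmult_const.
  - intros x Hx.
    apply (filterlim_comp_2 (G := locally (u4 x)) (H := locally (c * w4 x))).
    + now apply Cu.
    + apply filterlim_comp with (1 := Cw x Hx).
      apply (filterlim_scal_r (K := R_AbsRing) (V := R_NormedModule) c).
    + apply (filterlim_plus (K := R_AbsRing) (V := R_NormedModule)).
Qed.

Lemma maximum_principle_itv (m : R) (v v1 v2 v3 v4 : R -> R) :
  admissible m -> C4_itv v v1 v2 v3 v4 ->
  (forall x, 0 < x < 1 -> 0 <= v4 x + 4 * m ^ 4 * v x) ->
  0 <= v 0 -> 0 <= v 1 -> v2 0 <= 0 -> v2 1 <= 0 ->
  forall x, unit_itv x -> 0 <= v x.
Proof.
  intros Hm Hv Hop H0 H1 H20 H21 x Hx.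
  rewrite <- (clamp_id x Hx).
  assert (C0 : clamp 0 = 0) by (apply clamp_id; split; lra).
  assert (C1 : clamp 1 = 1) by (apply clamp_id; split; lra).
  apply (maximum_principle m _ _ _ _ _ Hm (smooth4_of_C4_itv _ _ _ _ _ Hv));
    rewrite ?C0, ?C1; auto.
  intros s Hs. rewrite clamp_id by (split; lra). auto.
Qed.

(** * The integro-differential problem *)

Lemma ex_RInt_cont_square_mult (k : R -> R -> R) (y : R -> R) (x : R) :
  cont_square k -> (forall t, continuous (fun s => y (clamp s)) t) -> unit_itv x ->
  ex_RInt (fun t => k x t * y t) 0 1.
Proof.
  intros Hk Hy Hx.
  apply (ex_RInt_ext (fun t => k x (clamp t) * y (clamp t))).
  - intros t Ht. rewrite Rmin_left, Rmax_right in Ht by lra.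
    rewrite clamp_id; [reflexivity | split; lra].
  - apply (ex_RInt_continuous (V := R_CompleteNormedModule)). intros t _.
    apply (continuous_mult (fun t => k x (clamp t)) (fun t => y (clamp t))).
    + now apply cont_square_clamp.
    + apply Hy.
Qed.

Lemma quartic_root_lt (k1 M : R) :
  0 < k1 -> 0 < M < 4 * k1 ^ 4 -> exists m, 0 < m < k1 /\ M = 4 * m ^ 4.
Proof.
  intros Hk HM. set (m := sqrt (sqrt (M / 4))).
  assert (Hs : 0 < sqrt (M / 4)) by (apply sqrt_lt_R0; lra).
  assert (Hm : 0 < m) by (apply sqrt_lt_R0; exact Hs).
  assert (Hm4 : M = 4 * m ^ 4).
  { replace (m ^ 4) with ((m * m) * (m * m)) by ring. unfold m.
    rewrite sqrt_sqrt by lra. rewrite sqrt_sqrt; lra. }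
  exists m. split; [split; [exact Hm |] | exact Hm4].
  destruct (Rlt_or_le m k1) as [H | H]; [exact H |].
  assert (k1 ^ 4 <= m ^ 4) by (apply pow_incr; lra). lra.
Qed.

Lemma integro_solution_opp (M N : R) (k : R -> R -> R) (p : R -> R) (A B C D : R) (y : R -> R) :
  cont_square k -> integro_solution M N k p A B C D y ->
  integro_solution M N k (fun x => - p x) (- A) (- B) (- C) (- D) (fun x => - y x).
Proof.
  intros Hk (y1 & y2 & y3 & y4 & HC4 & Heq & H0 & H1 & H2 & H3).
  assert (Hy : forall t, continuous (fun s => y (clamp s)) t) by apply (smooth4_of_C4_itv _ _ _ _ _ HC4).
  exists (fun x => - y1 x), (fun x => - y2 x), (fun x => - y3 x), (fun x => - y4 x).
  split; [| split; [| rewrite H0, H1, H2, H3; auto]].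
  - destruct HC4 as [Hd Hc]. split.
    + intros x Hx. destruct (Hd x Hx) as (D0 & D1 & D2 & D3).
      refine (conj _ (conj _ (conj _ _))); now apply Dopp.
    + intros x Hx. apply filterlim_comp with (1 := Hc x Hx).
      apply (filterlim_opp (K := R_AbsRing) (V := R_NormedModule)).
  - intros x Hx. rewrite <- (Heq x Hx).
    rewrite (RInt_ext _ (fun t => opp (k x t * y t))).
    2: { intros t _. unfold opp; simpl. ring. }
    rewrite (RInt_opp (V := R_CompleteNormedModule)).
    + unfold opp; simpl. ring.
    + apply ex_RInt_cont_square_mult; auto. split; lra.
Qed.

(** Comparison at the minimum of y with a multiple of the solution g for the
    constant right-hand side 1. *)
Lemma nonneg_of_nonneg_data (k G : R -> R -> R) (k1 M N knorm gmax : R)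
  (hk : cont_square k)
  (hk1 : is_k1 k1) (hM : 0 < M < 4 * k1 ^ 4)
  (hG : is_green M G)
  (hNk : forall x t, unit_itv x -> unit_itv t -> 0 <= N * k x t)
  (hknorm : is_sup_norm k knorm) (hgmax : is_max_int G gmax)
  (hbound : Rabs N * knorm * gmax < 1)
  (p : R -> R) (A B C D : R)
  (y : R -> R) (hy : integro_solution M N k p A B C D y) :
  (forall x, unit_itv x -> 0 <= p x) ->
  0 <= A -> 0 <= B -> C <= 0 -> D <= 0 ->
  forall x, unit_itv x -> 0 <= y x.
Proof.
  intros Hp HA HB HC HD.
  destruct (quartic_root_lt k1 M) as [m [Hm ->]]; [apply hk1 | exact hM |].
  assert (Hadm := admissible_of_lt_k1 k1 m hk1 Hm).
  destruct hy as (y1 & y2 & y3 & y4 & HC4 & Heq & H0 & H1 & H2 & H3).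
  assert (Hyc : forall t, continuous (fun s => y (clamp s)) t)
    by apply (smooth4_of_C4_itv _ _ _ _ _ HC4).
  destruct (continuity_ab_min (fun t => y (clamp t)) 0 1) as [xm [Hmin Hxm]].
  { lra. }
  { intros c _. apply continuity_pt_filterlim, Hyc. }
  set (mu := - y xm).
  assert (Hlow : forall x, unit_itv x -> - mu <= y x).
  { intros x Hx. assert (H := Hmin x Hx). rewrite !clamp_id in H by assumption.
    unfold mu. lra. }
  destruct (Rle_or_lt mu 0) as [Hmu | Hmu].
  { intros x Hx. assert (H := Hlow x Hx). lra. }
  exfalso.
  (* The integral term is bounded below by [- c]. *)
  set (c := mu * (Rabs N * knorm)).
  assert (Hknorm : forall x t, unit_itv x -> unit_itv t -> Rabs (k x t) <= knorm).
  { intros x t Hx Ht. apply hknorm. exists x, t. auto. }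
  assert (Hc : 0 <= c).
  { apply Rmult_le_pos; [lra |]. apply Rmult_le_pos; [apply Rabs_pos |].
    apply Rle_trans with (Rabs (k 0 0)); [apply Rabs_pos | apply Hknorm; split; lra]. }
  destruct hG as [_ hG]. destruct (hG (fun _ => 1)) as [Hg _].
  { intros x _. apply filterlim_const. }
  set (g := fun x => RInt (fun s => G x s * 1) 0 1) in Hg.
  assert (Hgmax : forall x, unit_itv x -> g x <= gmax).
  { intros x Hx. apply hgmax. exists x. split; [exact Hx |].
    apply RInt_ext. intros s _. apply Rmult_1_r. }
  destruct Hg as (g1 & g2 & g3 & g4 & HgC4 & Hgeq & G0 & G1 & G2 & G3).
  assert (Hint : forall x, 0 < x < 1 -> - c <= N * RInt (fun t => k x t * y t) 0 1).
  { intros x Hx. assert (Hxu : unit_itv x) by (split; lra).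
    assert (Hex := ex_RInt_cont_square_mult k y x hk Hyc Hxu).
    assert (E1 : RInt (fun t => - c) 0 1 = - c).
    { rewrite RInt_const. unfold scal; simpl. unfold mult; simpl. ring. }
    assert (E2 : RInt (fun t => N * (k x t * y t)) 0 1 = N * RInt (fun t => k x t * y t) 0 1).
    { exact (RInt_scal (V := R_CompleteNormedModule) _ 0 1 N Hex). }
    rewrite <- E1, <- E2. apply RInt_le.
    - lra.
    - apply ex_RInt_const.
    - exact (ex_RInt_scal (V := R_NormedModule) _ 0 1 N Hex).
    - intros t Ht. assert (Htu : unit_itv t) by (split; lra).
      assert (HN := hNk x t Hxu Htu). assert (Hy := Hlow t Htu).
      assert (HNle : N * k x t <= Rabs N * knorm).
      { apply Rle_trans with (Rabs (N * k x t)); [apply Rle_abs |].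
        rewrite Rabs_mult. apply Rmult_le_compat_l; [apply Rabs_pos | auto]. }
      assert (N * k x t * - mu <= N * k x t * y t) by (apply Rmult_le_compat_l; lra).
      assert (mu * (N * k x t) <= c) by (apply Rmult_le_compat_l; lra).
      lra. }
  assert (Hmp : forall x, unit_itv x -> 0 <= y x + c * g x).
  { apply (maximum_principle_itv m _ _ _ _ _ Hadm (C4_itv_lin_comb c _ _ _ _ _ _ _ _ _ _ HC4 HgC4));
      rewrite ?H0, ?H1, ?H2, ?H3, ?G0, ?G1, ?G2, ?G3; try lra.
    intros x Hx. assert (E := Heq x Hx). assert (Eg := Hgeq x Hx).
    assert (Hi := Hint x Hx). assert (Hpx := Hp x ltac:(split; lra)).
    fold (g x) in Eg.
    assert (c * (g4 x + 4 * m ^ 4 * g x) = c) by (rewrite Eg; ring). lra. }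
  assert (Hend := Hmp xm Hxm). assert (Hgm := Hgmax xm Hxm).
  assert (c * g xm <= c * gmax) by (apply Rmult_le_compat_l; lra).
  assert (mu * (Rabs N * knorm * gmax) < mu * 1) by (apply Rmult_lt_compat_l; lra).
  unfold c, mu in *. lra.
Qed.

(** For [gmax <= 0], where the quotient says nothing, the left-hand side is
    nonpositive. *)
Lemma contraction_bound (N knorm gmax : R) :
  N <> 0 -> 0 <= knorm -> knorm < 1 / (Rabs N * gmax) -> Rabs N * knorm * gmax < 1.
Proof.
  intros HN Hk Hb. assert (HNp := Rabs_pos_lt N HN).
  destruct (Rlt_or_le 0 gmax) as [Hg | Hg].
  - assert (Hp : 0 < Rabs N * gmax) by now apply Rmult_lt_0_compat.
    apply (Rmult_lt_compat_r _ _ _ Hp) in Hb.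
    replace (1 / (Rabs N * gmax) * (Rabs N * gmax)) with 1 in Hb by (field; lra). lra.
  - assert (0 <= Rabs N * knorm) by (apply Rmult_le_pos; lra).
    assert (Rabs N * knorm * gmax <= Rabs N * knorm * 0) by (apply Rmult_le_compat_l; lra). lra.
Qed.

Theorem theorem2p2 (k G : R -> R -> R) (k1 M N knorm gmax : R)
  (hk : cont_square k)
  (hk1 : is_k1 k1) (hM : 0 < M < 4 * k1 ^ 4) (hN : N <> 0)
  (hG : is_green M G)
  (hNk : forall x t, unit_itv x -> unit_itv t -> 0 <= N * k x t)
  (hknorm : is_sup_norm k knorm) (hgmax : is_max_int G gmax)
  (hbound : knorm < 1 / (Rabs N * gmax))
  (p : R -> R) (hp : cont_itv p) (A B C D : R)
  (y : R -> R) (hy : integro_solution M N k p A B C D y) :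
  ((forall x, unit_itv x -> 0 <= p x) ->
   0 <= A -> 0 <= B -> C <= 0 -> D <= 0 ->
   forall x, unit_itv x -> 0 <= y x) /\
  ((forall x, unit_itv x -> p x <= 0) ->
   A <= 0 -> B <= 0 -> 0 <= C -> 0 <= D ->
   forall x, unit_itv x -> y x <= 0).
Proof.
  assert (Hk : 0 <= knorm).
  { destruct hknorm as [(x & t & _ & _ & ->) _]. apply Rabs_pos. }
  assert (Hb := contraction_bound N knorm gmax hN Hk hbound).
  split.
  - intros Hp HA HB HC HD.
    now apply (nonneg_of_nonneg_data k G k1 M N knorm gmax hk hk1 hM hG hNk hknorm hgmax Hb p A B C D).
  - intros Hp HA HB HC HD x Hx.
    enough (0 <= - y x) by lra. revert x Hx.
    apply (nonneg_of_nonneg_data k G k1 M N knorm gmax hk hk1 hM hG hNk hknorm hgmax Hb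
             (fun x => - p x) (- A) (- B) (- C) (- D)); try lra.
    + now apply integro_solution_opp.
    + intros x Hx. assert (H := Hp x Hx). lra.
Qed.
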